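(* Let $0<q<1$, $t>0$ with $tq<1$, and $k\in\mathbb{N}$. Define the 2-negative binomialised Meixner factorial moment by $$M^{1,2}_q(k;t)=\int\left(\int x(x-1)\cdots(x-k+1)\,\mathrm{d}\rho^1_{m+1,q}(x)\right)\mathrm{d}\mu^2_{tq}(m).$$ Then $M^{1,2}_q(k;t)$ can be written in terms of a Legendre polynomial in the variable $(1+t)(1-t)^{-1}$: $$M^{1,2}_q(k;t)=k!\left(\frac{q}{(1-q)(1-tq)}\right)^k{}_2F_1\left(\begin{matrix}-k,-k\\ 1\end{matrix};t\right)=k!\left(\frac{q}{(1-q)(1-tq)}\right)^k(1-t)^kP_k\left(\frac{1+t}{1-t}\right).$$
   Context: Conventions: $\mathbb{N}=\{0,1,2,\dots\}$; an empty product is $1$. Hypergeometric notation: $(a)_i=a(a+1)\cdots(a+i-1)$ and ${}_2F_1\left(\begin{matrix}a,b\\ c\end{matrix};z\right)=\sum_{i\ge0}\frac{(a)_i(b)_i}{(c)_i}\frac{z^i}{i!}$, which terminates if $a$ or $b$ is a nonpositive integer. The negative binomial measure with parameters $0<q<1$, $\gamma>0$ is $\mu_q^\gamma(x)=\frac{(\gamma)_x}{x!}q^x(1-q)^\gamma$, $x\in\mathbb{N}$; in particular $\mu_q^1(x)=q^x(1-q)$ and $\mu^2_{tq}(m)=(m+1)(tq)^m(1-tq)^2$. The normalised Meixner polynomials with $\gamma=1$ are $m_n(x;1,q)=q^{n/2}\;{}_2F_1\left(\begin{matrix}-n,-x\\ 1\end{matrix};1-\frac1q\right)$, $n\in\mathbb{N}$.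 The Meixner ($\gamma=1$) one-point function with $N\ge1$ particles is the probability mass function on $\mathbb{N}$ given by $\rho^1_{N,q}(x)=\frac1N\sum_{n=0}^{N-1}m_n(x;1,q)^2\mu_q^1(x)$. Thus $M^{1,2}_q(k;t)=\sum_{m\ge0}(m+1)(tq)^m(1-tq)^2\sum_{x\ge0}x(x-1)\cdots(x-k+1)\rho^1_{m+1,q}(x)$. $P_k$ is the Legendre polynomial $P_k(x)={}_2F_1\left(\begin{matrix}-k,k+1\\ 1\end{matrix};\frac{1-x}{2}\right)$. The expression $(1-t)^kP_k\left(\frac{1+t}{1-t}\right)$ is a polynomial in $t$, and at $t=1$ it is understood as the value of this polynomial. *)

(* Defs.v *)
From HB Require Import structures.
From mathcomp Require Import all_boot all_order all_algebra.
From mathcomp Require Import all_classical all_reals all_analysis.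

Set Implicit Arguments.
Unset Strict Implicit.
Unset Printing Implicit Defensive.

Import Order.TTheory GRing.Theory Num.Theory.
Import numFieldNormedType.Exports.

Local Open Scope ring_scope.

(* Rising factorial (a)_i = a (a + 1) ... (a + i - 1). *)
Definition pochhammer (R : realType) (a : R) (i : nat) : R :=
  \prod_(j < i) (a + j%:R).

(* Gauss hypergeometric series, as the limit of its real partial sums; only
   meaningful where the series converges, in particular when it terminates. *)
Definition hyp2F1 (R : realType) (a b c z : R) : R :=
  limn (series (fun i : nat =>
    pochhammer a i * pochhammer b i / pochhammer c i * (z ^+ i / i`!%:R))).

Definition legendre (R : realType) (k : nat) (x : R) : R :=
  hyp2F1 (- k%:R) (k%:R + 1) 1 ((1 - x) / 2).

(* Mass function of the negative binomial measure, parameters q and gamma. *)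
Definition negbin (R : realType) (q gamma : R) (x : nat) : R :=
  pochhammer gamma x / x`!%:R * q ^+ x * (1 - q) `^ gamma.

(* Normalised Meixner polynomial m_n(x; 1, q), at x in nat. *)
Definition meixner (R : realType) (n : nat) (q : R) (x : nat) : R :=
  q `^ (n%:R / 2) * hyp2F1 (- n%:R) (- x%:R) 1 (1 - q^-1).

(* Meixner one-point function (gamma = 1) with N >= 1 particles. *)
Definition meixner_density (R : realType) (N : nat) (q : R) (x : nat) : R :=
  N%:R^-1 * \sum_(n < N) meixner n q x ^+ 2 * negbin q 1 x.

(* Integral of f against the measure on nat with mass function p.  It is taken
   in \bar R, so that an equation with a finite value includes convergence;
   it is the integral whenever f and p are nonnegative. *)
Definition pmf_integral (R : realType) (p : nat -> R) (f : nat -> \bar R)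
    : \bar R :=
  (\sum_(0 <= x <oo) f x * (p x)%:E)%E.

(* M^{1,2}_q(k; t); x ^_ k is the falling factorial x (x - 1) ... (x - k + 1). *)
Definition binomialised_moment (R : realType) (q : R) (k : nat) (t : R)
    : \bar R :=
  pmf_integral (negbin (t * q) 2) (fun m =>
    pmf_integral (meixner_density m.+1 q) (fun x => ((x ^_ k)%:R)%:E)).

(* Main.v *)
Require Import Defs.
From mathcomp Require Import all_boot all_order all_algebra.
From mathcomp Require Import all_classical all_reals all_analysis.
From mathcomp Require Import ring zify.

(* Write F_n(x) = sum_i C(n,i) C(x,i) (1 - 1/q)^i, so that m_n^2 = q^n F_n^2.
   From sum_n F_n(x) a^n = (1 - a/q)^x / (1 - a)^(x+1) one finds
     sum_x C(x,k) q^x F_n(x) F_m(x) = [a^n b^m]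
       q^k ((1 - a/q) (1 - b/q))^k / ((1 - q) (1 - ab/q))^(k+1):
   the terms linear in a and b alone cancel from the denominator.  On the
   diagonal n = m only the squares C(k,j)^2 survive, with positive coefficients,
   and the remaining sums over n <= m and over m are hockey-stick and negative
   binomial sums.  The two-variable identity is proved by induction on k, n, m
   from a summation by parts in x, whose boundary term is a polynomial times q^N.
   The Legendre form expands [X^k] (1 + X)^k (1 + s X)^k in two ways. *)

Set Implicit Arguments.
Unset Strict Implicit.
Unset Printing Implicit Defensive.

Import Order.TTheory GRing.Theory Num.Theory.
Import numFieldNormedType.Exports.

Local Open Scope ring_scope.

(** * Terminating hypergeometric sums and the Legendre form *)

Section Hypergeometric.
Variable R : realType.
Implicit Types (a b c z q : R) (n i x k : nat).

Lemma pochhammer_opp n i :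
  pochhammer (- n%:R : R) i = (- 1) ^+ i * (i`! * 'C(n, i))%:R.
Proof.
rewrite mulnC bin_ffact /pochhammer.
elim: i => [|i IH]; first by rewrite big_ord0 ffactn0 mulr1.
rewrite big_ord_recr /= IH ffactnSr natrM exprS.
have [le_in|lt_ni] := leqP i n; first by rewrite natrB//; ring.
by rewrite ffact_small// !(mul0r, mulr0).
Qed.

Lemma pochhammer_nat n i :
  pochhammer (n.+1%:R : R) i = (i`! * 'C(n + i, i))%:R.
Proof.
rewrite mulnC bin_ffact /pochhammer.
elim: i => [|i IH]; first by rewrite big_ord0 ffactn0.
by rewrite big_ord_recr /= IH addnS ffactSS natrM mulrC -natrD addSn.
Qed.

Lemma pochhammer1 i : pochhammer (1 : R) i = i`!%:R.
Proof. by rewrite (pochhammer_nat 0) add0n binn muln1. Qed.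

Lemma hyp2F1_terminating n b c z :
  hyp2F1 (- n%:R) b c z = \sum_(i < n.+1)
    (- 1) ^+ i * 'C(n, i)%:R * (pochhammer b i / pochhammer c i * z ^+ i).
Proof.
apply: lim_near_cst => //; exists n.+1 => // N /= leN.
rewrite seriesEord /= -(subnKC leN) big_split_ord /= [X in _ + X]big1 ?addr0;
  last first.
  move=> i _; rewrite pochhammer_opp bin_small ?muln0 ?mulr0 ?mul0r//.
  by rewrite addSn ltnS leq_addr.
apply: eq_bigr => i _; rewrite pochhammer_opp natrM.
have : (i`!%:R : R) != 0 by rewrite pnatr_eq0 -lt0n fact_gt0.
(* The inverse of [pochhammer c i], which may vanish, is generalised, so that [field] only needs the
   factorial to be nonzero. *)
by move: (_^-1) => w h; field.
Qed.

Lemma hyp2F1_opp2 n x z :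
  hyp2F1 (- n%:R) (- x%:R) 1 z =
  \sum_(i < n.+1) ('C(n, i) * 'C(x, i))%:R * z ^+ i.
Proof.
rewrite hyp2F1_terminating; apply: eq_bigr => i _.
rewrite pochhammer_opp pochhammer1 !natrM.
have h : (i`!%:R : R) != 0 by rewrite pnatr_eq0 -lt0n fact_gt0.
transitivity ((-1) ^+ i * (-1) ^+ i * ('C(n, i)%:R * 'C(x, i)%:R * z ^+ i)).
  by field.
by rewrite -exprMn mulrNN mulr1 expr1n mul1r.
Qed.

(* Both sides are the coefficient of X^k in (1 + X)^k (1 + s X)^k, the right one
   through 1 + s X = (1 - s) + s (1 + X). *)
Lemma sum_sqr_bin k (s : R) :
  \sum_(j < k.+1) ('C(k, j) * 'C(k, j))%:R * s ^+ j =
  \sum_(i < k.+1) ('C(k, i) * 'C(k + i, i))%:R * s ^+ i * (1 - s) ^+ (k - i).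
Proof.
have coef_pow m i (y : R) : ((1 + y *: 'X) ^+ m)`_i = 'C(m, i)%:R * y ^+ i.
  rewrite exprDn coef_sum (eq_bigr (fun j : 'I_m.+1 =>
      if (j == i :> nat) then 'C(m, i)%:R * y ^+ i else 0)); last first.
    move=> j _; rewrite expr1n mul1r exprZn coefMn coefZ coefXn eq_sym.
    case: eqP => [->|_]; last by rewrite mulr0 mul0rn.
    by rewrite mulr1 mulr_natl.
  case: (ltnP i m.+1) => [lt|le].
    rewrite (bigD1 (Ordinal lt)) //= eqxx big1 ?addr0// => j /negbTE.
    by rewrite -val_eqE /= => ->.
  rewrite bin_small// mul0r big1// => j _; case: eqP => // e.
transitivity (((1 + 1 *: 'X) ^+ k * (1 + s *: 'X) ^+ k)`_k).
  rewrite coefMr; apply: eq_bigr => j _.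
  rewrite !coef_pow expr1n mulr1 natrM bin_sub ?mulrA//.
  by rewrite -ltnS.
rewrite -exprMn.
have -> : (1 + 1 *: 'X) * (1 + s *: 'X) =
   (1 + 1 *: 'X) * ((1 - s)%:P + s *: (1 + 1 *: 'X)) :> {poly R}.
  by rewrite polyCB !scale1r scalerDr alg_polyC addrA subrK.
rewrite exprMn [X in _ * X]exprDn mulr_sumr coef_sum; apply: eq_bigr => i _.
have -> : (1 + 1 *: 'X) ^+ k *
    ((1 - s)%:P ^+ (k - i) * (s *: (1 + 1 *: 'X)) ^+ i *+ 'C(k, i)) =
    ((1 - s) ^+ (k - i) * s ^+ i * 'C(k, i)%:R) *: (1 + 1 *: 'X) ^+ (k + i).
  rewrite exprZn -rmorphXn /= mul_polyC scalerA exprD -scaler_nat.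
  by rewrite -!scalerAr !scalerA [_%:R * _]mulrC.
have -> : 'C(k + i, i) = 'C(k + i, k) by rewrite -bin_sub ?leq_addl// addnK.
by rewrite coefZ coef_pow expr1n mulr1 natrM; ring.
Qed.

(** The argument of the Legendre series becomes -s / (1 - s), so the factor (1 - s)^k clears all
    denominators and leaves the right side of [sum_sqr_bin]. *)
Lemma legendre_polynomial k (s : R) : s != 1 ->
  (1 - s) ^+ k * legendre k ((1 + s) / (1 - s)) =
  \sum_(j < k.+1) ('C(k, j) * 'C(k, j))%:R * s ^+ j.
Proof.
move=> s1; have s0 : 1 - s != 0 by rewrite subr_eq0 eq_sym.
rewrite sum_sqr_bin /legendre hyp2F1_terminating mulr_sumr.
apply: eq_bigr => i _.
have -> : (1 - (1 + s) / (1 - s)) / 2 = - (s / (1 - s)) by field.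
rewrite natr1 pochhammer_nat pochhammer1 natrM [(- (s / _)) ^+ _]exprNn.
rewrite expr_div_n.
have h : (i`!%:R : R) != 0 by rewrite pnatr_eq0 -lt0n fact_gt0.
have e : (1 - s) ^+ k = (1 - s) ^+ (k - i) * (1 - s) ^+ i.
  by rewrite -exprD subnK// -ltnS.
have hs : (1 - s) ^+ i != 0 by rewrite expf_neq0.
rewrite e natrM.
transitivity ((-1) ^+ i * (-1) ^+ i *
    ('C(k, i)%:R * 'C(k + i, i)%:R * s ^+ i * (1 - s) ^+ (k - i))).
  by field; rewrite h hs.
by rewrite -exprMn mulrNN mulr1 expr1n mul1r.
Qed.

End Hypergeometric.

(** * Growth bounds for the boundary terms of the summation by parts *)

Section Growth.
Local Open Scope classical_set_scope.
Variable R : realType.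
Implicit Types (u v : nat -> R) (r : R).

(** Quantifying over every ratio r makes the class closed under products: r^x splits into two powers
    of the square root of r. *)
Definition subexponential u :=
  forall r, 0 < r < 1 -> u x * r ^+ x @[x --> \oo] --> (0 : R).

Lemma cvg_expr01 r : 0 < r < 1 -> r ^+ x @[x --> \oo] --> (0 : R).
Proof. by move=> /andP[r0 r1]; apply: cvg_expr; rewrite gtr0_norm. Qed.

Lemma subexponential_cst (c : R) : subexponential (fun=> c).
Proof.
move=> r r01; rewrite -(mulr0 c).
by apply: cvgM; [exact: cvg_cst | exact: cvg_expr01].
Qed.

Lemma subexponentialD u v :
  subexponential u -> subexponential v -> subexponential (fun x => u x + v x).
Proof.
move=> hu hv r r01; under eq_fun do rewrite mulrDl.
by rewrite -[0]addr0; apply: cvgD; [exact: hu | exact: hv].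
Qed.

Lemma sqrt01 r : 0 < r < 1 -> 0 < Num.sqrt r < 1.
Proof. by move=> /andP[r0 r1]; rewrite sqrtr_gt0 r0 -[ltRHS]sqrtr1 ltr_sqrt. Qed.

Lemma sqrt_expr r x : 0 < r < 1 -> r ^+ x = Num.sqrt r ^+ x * Num.sqrt r ^+ x.
Proof. by move=> /andP[r0 r1]; rewrite -exprMn -expr2 sqr_sqrtr ?ltW. Qed.

Lemma subexponentialM u v :
  subexponential u -> subexponential v -> subexponential (fun x => u x * v x).
Proof.
move=> hu hv r r01; under eq_fun do rewrite (sqrt_expr _ r01) mulrACA.
by rewrite -(mulr0 0); apply: cvgM; [exact/hu/sqrt01 | exact/hv/sqrt01].
Qed.

Lemma subexponential_nat : subexponential (fun x => x%:R).
Proof.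
move=> r r01; have /andP[s0 s1] := sqrt01 r01; set s := Num.sqrt r in s0 s1 *.
have bound x : x%:R * s ^+ x <= (1 - s)^-1.
  rewrite -[leRHS]mul1r ler_pdivlMr ?subr_gt0//.
  elim: x => [|x IH]; first by rewrite !mul0r ler01.
  have sx : s ^+ x.+1 <= 1 by rewrite exprn_ile1// ltW.
  (* A convex combination, with weights s and 1 - s, of the previous value and s^(x+1), both at most
     1. *)
  have -> : x.+1%:R * s ^+ x.+1 * (1 - s) =
      s * (x%:R * s ^+ x * (1 - s)) + (1 - s) * s ^+ x.+1.
    by rewrite -natr1 exprS; ring.
  rewrite -[leRHS](subrKC s) lerD//.
    by rewrite -[leRHS]mulr1 ler_wpM2l// ltW.
  by rewrite -[leRHS]mulr1 ler_wpM2l// subr_ge0 ltW.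
apply: (@squeeze_cvgr _ _ _ _ (fun=> 0) (fun x => (1 - s)^-1 * s ^+ x)).
- apply: nearW => x; rewrite (sqrt_expr _ r01).
  rewrite mulr_ge0 ?mulr_ge0 ?exprn_ge0 ?sqrtr_ge0//=.
  by rewrite mulrA ler_wpM2r// exprn_ge0// ltW.
- exact: cvg_cst.
- by rewrite -(mulr0 (1 - s)^-1); apply: cvgM;
    [exact: cvg_cst | apply: cvg_expr01; rewrite s0].
Qed.

Lemma subexponential_sum (I : Type) (s : seq I) (f : I -> nat -> R) :
  (forall i, subexponential (f i)) ->
  subexponential (fun x => \sum_(i <- s) f i x).
Proof.
move=> hf; elim: s => [|i s IH].
  by under eq_fun do rewrite big_nil; exact: subexponential_cst.
by under eq_fun do rewrite big_cons; exact: subexponentialD.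
Qed.

Lemma subexponential_bin k : subexponential (fun x => 'C(x, k)%:R).
Proof.
elim: k => [|k IH].
  by under eq_fun do rewrite bin0; exact: subexponential_cst.
have -> : (fun x => 'C(x, k.+1)%:R) =
    (fun x => k.+1%:R^-1 * ('C(x, k)%:R * (x%:R + - k%:R))) :> (nat -> R).
  apply/funext => x; apply: (canRL (mulKf _)); rewrite ?pnatr_eq0//.
  rewrite -natrM mul_bin_left mulnC natrM.
  have [le_kx|lt_xk] := leqP k x; first by rewrite natrB.
  by rewrite bin_small// !mul0r.
apply: subexponentialM; first exact: subexponential_cst.
apply: subexponentialM => //.
by apply: subexponentialD;
  [exact: subexponential_nat | exact: subexponential_cst].
Qed.

End Growth.

(** * Binomial moments of products of two Meixner polynomials *)

Section MeixnerGram.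
Local Open Scope classical_set_scope.
Variables (R : realType) (q : R).
Hypotheses (q_gt0 : 0 < q) (q_lt1 : q < 1).
Implicit Types (n m k l x : nat) (z : R).

Definition meixner_sum z n x : R :=
  \sum_(i < n.+1) ('C(n, i) * 'C(x, i))%:R * z ^+ i.

Lemma meixner_sum_widen z n x N : (n < N)%N ->
  meixner_sum z n x = \sum_(i < N) ('C(n, i) * 'C(x, i))%:R * z ^+ i.
Proof.
move=> lt_nN.
rewrite /meixner_sum (big_ord_widen_cond _ xpredT
  (fun i => ('C(n, i) * 'C(x, i))%:R * z ^+ i) lt_nN).
rewrite big_mkcond; apply: eq_bigr => i _ /=.
by case: leqP => // lt_ni; rewrite bin_small// mul0n mul0r.
Qed.

(** By Pascal's rule in both arguments, the mixed difference of C(n,i) C(x,i) in n and x is C(n,i-1)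
    C(x,i-1). *)
Lemma meixner_sum_rec z n x :
  meixner_sum z n.+1 x.+1 - meixner_sum z n x.+1 =
  meixner_sum z n.+1 x - meixner_sum z n x + z * meixner_sum z n x.
Proof.
have -> : z * meixner_sum z n x =
    \sum_(i < n.+1) ('C(n, i) * 'C(x, i))%:R * z ^+ i.+1.
  by rewrite mulr_sumr; apply: eq_bigr => i _; rewrite exprS mulrCA.
rewrite !(@meixner_sum_widen _ _ _ n.+2)//.
rewrite ![\sum_(i < n.+2) _]big_ord_recl !bin0.
rewrite [in LHS]opprD addrACA subrr add0r [in RHS]opprD addrACA subrr add0r.
rewrite -!sumrB -big_split /=; apply: eq_bigr => i _.
rewrite !binS !natrM !natrD; ring.
Qed.

(* The shift by one index (F_(-1) = 0) lets the recurrences in n hold at n = 0. *)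
Definition smeixner n x : R :=
  if n is n'.+1 then meixner_sum (1 - q^-1) n' x else 0.

Lemma smeixner_rec n x :
  smeixner n.+1 x.+1 - smeixner n x.+1 = smeixner n.+1 x - q^-1 * smeixner n x.
Proof.
case: n => [|n] /=; first by rewrite /meixner_sum !big_ord1 !bin0; ring.
by rewrite meixner_sum_rec; ring.
Qed.

Lemma smeixner0 n : smeixner n.+1 0 - smeixner n 0 = (n == 0)%:R.
Proof.
have b0 z i : meixner_sum z i 0 = 1.
  rewrite /meixner_sum big_ord_recl big1 ?addr0 ?bin0 ?mulr1// => j _.
  by rewrite bin0n muln0 mul0r.
by case: n => [|n] /=; rewrite !b0 ?subr0 ?subrr.
Qed.

Lemma subexponential_smeixner n : subexponential (smeixner n).
Proof.
case: n => [|n]; first exact: subexponential_cst.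
apply: subexponential_sum => i.
under eq_fun do rewrite natrM.
apply: subexponentialM; last exact: subexponential_cst.
apply: subexponentialM; last exact: subexponential_bin.
exact: subexponential_cst.
Qed.

(** Write D(x) for the product of the two differences in the boundary term and E(x) for the product
    with the factors 1/q. By [smeixner_rec], D(x+1) = E(x), so w(x) q^x D(x) telescopes. In q E - D
    the cross terms cancel, leaving only the products with indices (n+1, m+1) and (n, m). *)
Lemma smeixner_by_parts (w : nat -> R) n m N :
  (1 - q) * series (fun x => w x * q ^+ x * (smeixner n.+1 x * smeixner m.+1 x)) N
  = (q^-1 - 1) * series (fun x => w x * q ^+ x * (smeixner n x * smeixner m x)) N
  + q * series (fun x => (w x.+1 - w x) * q ^+ x *
      ((smeixner n.+1 x - q^-1 * smeixner n x) *
       (smeixner m.+1 x - q^-1 * smeixner m x))) N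
  + w 0 * ((n == 0) && (m == 0))%:R
  - w N * q ^+ N * ((smeixner n.+1 N - smeixner n N) *
                    (smeixner m.+1 N - smeixner m N)).
Proof.
have q0 : q != 0 by rewrite gt_eqF.
elim: N => [|N IH].
  rewrite !seriesEord /= !big_ord0 !smeixner0 -natrM mulnb; ring.
by rewrite !seriesSr !smeixner_rec !mulrDr IH exprS; field.
Qed.

(* The coefficient of a^i in a (1 - a / q)^k. *)
Definition sbin k i : R :=
  if i is j.+1 then (- q^-1) ^+ j * 'C(k, j)%:R else 0.

Lemma sbin_rec k i l :
  sbin k.+1 (i.+1 - l) = sbin k (i.+1 - l) - q^-1 * sbin k (i - l).
Proof.
have [le_li|lt_il] := leqP l i; last first.
  by rewrite (eqP lt_il) (eqP (ltnW lt_il)) /= mulr0 subr0.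
rewrite subSn//; case: (i - l)%N => [|j] /=; first by rewrite !bin0; ring.
by rewrite binS natrD exprS; ring.
Qed.

(* The coefficient of a^n b^m in
   a b ((1 - a / q) (1 - b / q))^k / (1 - a b / q)^(k + 1); where [m - l] is
   truncated, the summand vanishes, as [sbin k 0 = 0]. *)
Definition gram_coef k n m : R :=
  \sum_(l < n) 'C(l + k, k)%:R * q^-1 ^+ l *
    (sbin k (n - l) * sbin k (m - l)).

Lemma gram_coef_rec0 n m :
  gram_coef 0 n.+1 m.+1 = q^-1 * gram_coef 0 n m + ((n == 0) && (m == 0))%:R.
Proof.
rewrite /gram_coef big_ord_recl addrC mulr_sumr; congr (_ + _).
  apply: eq_bigr => l _; rewrite lift0 !subSS !bin0 exprS; ring.
rewrite !subn0 bin0 /= expr0 !mul1r.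
case: n => [|n] /=; last by rewrite mulr0 mul0r.
by case: m => [|m] /=; rewrite ?mulr0// bin0; ring.
Qed.

(** For the generating function H_k of [gram_coef k], this is (1 - ab/q) H_(k+1) = (1 - a/q) (1 -
    b/q) H_k, read at a^(n+1) b^(m+1). *)
Lemma gram_coef_rec k n m :
  gram_coef k.+1 n.+1 m.+1 = q^-1 * gram_coef k.+1 n m
   + (gram_coef k n.+1 m.+1 - q^-1 * (gram_coef k n.+1 m + gram_coef k n m.+1)
      + q^-1 ^+ 2 * gram_coef k n m).
Proof.
have widen i : gram_coef k n i =
    \sum_(l < n.+1) 'C(l + k, k)%:R * q^-1 ^+ l *
      (sbin k (n - l) * sbin k (i - l)).
  by rewrite big_ord_recr /= subnn mul0r mulr0 addr0.
rewrite !widen mulrDr !mulr_sumr -big_split -sumrB -big_split /=.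
(* Shifting l by one gives both sums the same range and powers, so that Pascal's rule merges the
   binomials. *)
have -> : \sum_(l < n) q^-1 * ('C(l + k.+1, k.+1)%:R * q^-1 ^+ l *
      (sbin k.+1 (n - l) * sbin k.+1 (m - l))) =
    \sum_(l < n.+1) 'C(l + k, k.+1)%:R * q^-1 ^+ l *
      (sbin k.+1 (n.+1 - l) * sbin k.+1 (m.+1 - l)).
  rewrite [RHS]big_ord_recl bin_small// !mul0r add0r; apply: eq_bigr => l _.
  by rewrite lift0 !subSS addSnnS exprS; ring.
rewrite -big_split /=; apply: eq_bigr => l _.
rewrite addnS binS natrD !sbin_rec; ring.
Qed.

(** With w(x) = C(x,k), [smeixner_by_parts] becomes in the limit the recurrence of [gram_coef]: the
    difference of w lowers k, and the boundary term tends to 0. *)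
Lemma smeixner_series_cvg k n m :
  series (fun x => 'C(x, k)%:R * q ^+ x * (smeixner n x * smeixner m x)) N
    @[N --> \oo] -->
  q ^+ k / (1 - q) ^+ k.+1 * gram_coef k n m.
Proof.
have q0 : q != 0 by rewrite gt_eqF.
have q1 : 1 - q != 0 by rewrite subr_eq0 gt_eqF.
have zero i j a : (i == 0) || (j == 0) ->
    series (fun x => 'C(x, a)%:R * q ^+ x * (smeixner i x * smeixner j x)) =
    fun=> 0.
  move=> ij; apply/funext => N; rewrite seriesEord /= big1// => x _.
  by case/orP: ij => /eqP -> /=; rewrite ?mul0r !mulr0.
have conv0 i j a : (i == 0) || (j == 0) -> gram_coef a i j = 0.
  case/orP => /eqP ->; first by rewrite /gram_coef big_ord0.
  by rewrite /gram_coef big1// => l _ /=; rewrite !mulr0.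
have bdry a i j :
    'C(N, a)%:R * q ^+ N * ((smeixner i.+1 N - smeixner i N) *
      (smeixner j.+1 N - smeixner j N))
    @[N --> \oo] --> (0 : R).
  under eq_fun do rewrite mulrAC.
  have e l : subexponential (fun x => smeixner l.+1 x - smeixner l x).
    apply: subexponentialD; first exact: subexponential_smeixner.
    under eq_fun do rewrite -mulN1r.
    by apply: subexponentialM;
      [exact: subexponential_cst | exact: subexponential_smeixner].
  have := subexponentialM (subexponential_bin a) (subexponentialM (e i) (e j)).
  by apply; rewrite q_gt0.
elim: k n m => [|k IHk] n; elim: n => [|n IHn] [|m];
  try by rewrite conv0 ?zero ?mulr0 //; exact: cvg_cst.
(* For k = 0 the weight is constant, so its difference contributes nothing and w(0) = 1 supplies the
   initial value. *)
- have -> : series (fun x => 'C(x, 0)%:R * q ^+ x *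
        (smeixner n.+1 x * smeixner m.+1 x)) =
     (fun N => (1 - q)^-1 * ((q^-1 - 1) *
        series (fun x => 'C(x, 0)%:R * q ^+ x *
          (smeixner n x * smeixner m x)) N
      + ((n == 0) && (m == 0))%:R
      - 'C(N, 0)%:R * q ^+ N * ((smeixner n.+1 N - smeixner n N) *
                              (smeixner m.+1 N - smeixner m N)))).
    apply/funext => N; apply: (canRL (mulKf q1)).
    rewrite (smeixner_by_parts (fun x => 'C(x, 0)%:R)) bin0 mul1r.
    congr (_ + _ - _).
    rewrite [X in q * X](_ : _ = 0) ?mulr0 ?addr0// seriesEord /= big1// => x _.
    by rewrite !bin0 subrr !mul0r.
  have -> : q ^+ 0 / (1 - q) ^+ 1 * gram_coef 0 n.+1 m.+1 =
      (1 - q)^-1 * ((q^-1 - 1) * (q ^+ 0 / (1 - q) ^+ 1 * gram_coef 0 n m)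
        + ((n == 0) && (m == 0))%:R - 0).
    by rewrite gram_coef_rec0; field; rewrite q1.
  apply: cvgM; first exact: cvg_cst.
  apply: cvgB; last exact: bdry.
  apply: cvgD; last exact: cvg_cst.
  by apply: cvgM; [exact: cvg_cst | exact: IHn].
(* For k + 1 the difference of the weight is C(x,k), and w(0) = 0. *)
- pose S i j := series (fun x =>
      'C(x, k)%:R * q ^+ x * (smeixner i x * smeixner j x)).
  have -> : series (fun x => 'C(x, k.+1)%:R * q ^+ x *
        (smeixner n.+1 x * smeixner m.+1 x)) =
     (fun N => (1 - q)^-1 * ((q^-1 - 1) *
        series (fun x => 'C(x, k.+1)%:R * q ^+ x *
          (smeixner n x * smeixner m x)) N
      + q * (S n.+1 m.+1 N - q^-1 * (S n.+1 m N + S n m.+1 N)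
             + q^-1 ^+ 2 * S n m N)
      - 'C(N, k.+1)%:R * q ^+ N * ((smeixner n.+1 N - smeixner n N) *
                              (smeixner m.+1 N - smeixner m N)))).
    apply/funext => N; apply: (canRL (mulKf q1)).
    rewrite (smeixner_by_parts (fun x => 'C(x, k.+1)%:R)) bin_small//.
    rewrite mul0r addr0.
    congr (_ + _ * _ - _); rewrite /S !seriesEord /= mulrDr !mulr_sumr.
    rewrite -big_split -sumrB -big_split /=; apply: eq_bigr => x _.
    by rewrite binS natrD; ring.
  have -> : q ^+ k.+1 / (1 - q) ^+ k.+2 * gram_coef k.+1 n.+1 m.+1 =
      (1 - q)^-1 * ((q^-1 - 1) *
           (q ^+ k.+1 / (1 - q) ^+ k.+2 * gram_coef k.+1 n m)
       + q * (q ^+ k / (1 - q) ^+ k.+1 * gram_coef k n.+1 m.+1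
          - q^-1 * (q ^+ k / (1 - q) ^+ k.+1 * gram_coef k n.+1 m
                    + q ^+ k / (1 - q) ^+ k.+1 * gram_coef k n m.+1)
          + q^-1 ^+ 2 * (q ^+ k / (1 - q) ^+ k.+1 * gram_coef k n m)) - 0).
    have qk : (1 - q) ^+ k != 0 by rewrite expf_neq0.
    by rewrite gram_coef_rec !exprS; field; rewrite ?qk ?q1.
  apply: cvgM; first exact: cvg_cst.
  apply: cvgB; last exact: bdry.
  apply: cvgD; first by apply: cvgM; [exact: cvg_cst | exact: IHn].
  apply: cvgM; first exact: cvg_cst.
  apply: cvgD; last by apply: cvgM; [exact: cvg_cst | exact: IHk].
  apply: cvgB; first exact: IHk.
  by apply: cvgM; [exact: cvg_cst | apply: cvgD; exact: IHk].
Qed.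

(** The case n = m = 1 of the Gram series, as [smeixner] of index 1 is F_0 = 1. *)
Lemma binomial_series_cvg k :
  series (fun x => 'C(x, k)%:R * q ^+ x) N @[N --> \oo] -->
  q ^+ k / (1 - q) ^+ k.+1.
Proof.
have := @smeixner_series_cvg k 1 1.
have meixner1 x : smeixner 1 x = 1.
  by rewrite /= /meixner_sum big_ord1 !bin0 expr0 mulr1.
under eq_fun do under eq_fun do rewrite meixner1 !mulr1.
by rewrite /gram_coef big_ord1 /= binn !bin0 !expr0 !mulr1.
Qed.

End MeixnerGram.

(** * From the Gram series to the binomialised moment *)

Section Moments.
Local Open Scope classical_set_scope.
Variable R : realType.
Implicit Types (n m k l x j : nat) (w q : R).

Lemma eseries_EFin (f : nat -> R) (l : R) :
  series f N @[N --> \oo] --> l -> (\sum_(0 <= x <oo) (f x)%:E)%E = l%:E.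
Proof.
move=> fl; rewrite -(cvg_lim _ fl)// -EFin_lim; last by apply/cvg_ex; exists l.
by apply: congr_lim; apply/funext => N /=; rewrite sumEFin.
Qed.

Lemma series_mull c (f : nat -> R) :
  series (fun x => c * f x) = (fun N => c * series f N).
Proof. by apply/funext => N; rewrite !seriesEord /= mulr_sumr. Qed.

Lemma series_sum n (f : 'I_n -> nat -> R) :
  series (fun x => \sum_(i < n) f i x) = (fun N => \sum_(i < n) series (f i) N).
Proof.
apply/funext => N; rewrite seriesEord /= exchange_big; apply: eq_bigr => i _.
by rewrite seriesEord.
Qed.

Lemma shifted_binomial_series_cvg w p j : 0 < w < 1 -> (j <= p)%N ->
  series (fun m => 'C(m + p - j, p)%:R * w ^+ m) N @[N --> \oo] -->
  w ^+ j / (1 - w) ^+ p.+1.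
Proof.
move=> /andP[w0 w1] le_jp; have wn0 : w != 0 by rewrite gt_eqF.
have d0 : w ^+ (p - j) != 0 by rewrite expf_neq0.
(* Substitute x = m + (p - j); the terms added below p - j vanish because C(x,p) = 0 there. *)
have -> : series (fun m => 'C(m + p - j, p)%:R * w ^+ m) = (fun N =>
    (w ^+ (p - j))^-1 * series (fun x => 'C(x, p)%:R * w ^+ x) (N + (p - j))%N).
  apply/funext => N; apply: (canRL (mulKf d0)).
  rewrite !seriesEord /= addnC big_split_ord /=.
  rewrite [X in _ = X + _]big1 ?add0r => [|i _].
    rewrite mulr_sumr; apply: eq_bigr => i _.
    by rewrite mulrCA -exprD addnBAC// [(i + p)%N]addnC.
  by rewrite bin_small ?mul0r// (leq_trans (ltn_ord i))// leq_subr.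
have -> : w ^+ j / (1 - w) ^+ p.+1 =
    (w ^+ (p - j))^-1 * (w ^+ p / (1 - w) ^+ p.+1).
  by rewrite -[in w ^+ p](subnK le_jp) exprD mulrA mulKf.
apply: cvgM; first exact: cvg_cst.
have := @binomial_series_cvg _ _ w0 w1 p.
by rewrite -(cvg_shiftn (p - j)).
Qed.

(** After the reversal j = n - l, both sides truncate one sum whose terms vanish for j > n and for j
    > k. *)
Lemma binomial_convolution k n (d : nat -> R) :
  (forall j, (k < j)%N -> d j = 0) ->
  \sum_(l < n.+1) 'C(l + k, k)%:R * d (n - l)%N =
  \sum_(j < k.+1) 'C(n + k - j, k)%:R * d j.
Proof.
move=> d0; pose F j := 'C(n + k - j, k)%:R * d j.
have F0 j : (n < j)%N || (k < j)%N -> F j = 0.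
  rewrite /F; case/orP => h; last by rewrite d0// mulr0.
  (* Beyond n + k the truncated difference is 0 and C(0,k) is 1 when k = 0, so here the vanishing
     comes from d. *)
  have [le_j|lt_j] := leqP j (n + k); last by rewrite d0 ?mulr0//; lia.
  by rewrite bin_small ?mul0r//; lia.
have widen a N : (a < N)%N -> (forall j, (a < j)%N -> F j = 0) ->
    \sum_(j < a.+1) F j = \sum_(j < N) F j.
  move=> aN Fa; rewrite (big_ord_widen_cond _ xpredT F aN) big_mkcond.
  by apply: eq_bigr => j _ /=; case: leqP => // ?; rewrite Fa.
transitivity (\sum_(j < n.+1) F j).
  rewrite (reindex_inj rev_ord_inj); apply: eq_bigr => l _ /=; rewrite /F.
  have ln := ltn_ord l; have -> : (n.+1 - l.+1 + k = n + k - l)%N by lia.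
  by rewrite subSS subKn.
rewrite (widen n (n + k).+1) ?(widen k (n + k).+1)//; try lia.
- by move=> j jk; rewrite F0// jk orbT.
- by move=> j jn; rewrite F0// jn.
Qed.

(** Hockey-stick summation over n; j <= k keeps the subtractions genuine. *)
Lemma binomial_convolution_sum k m (d : nat -> R) :
  (forall j, (k < j)%N -> d j = 0) ->
  \sum_(n < m.+1) \sum_(l < n.+1) 'C(l + k, k)%:R * d (n - l)%N =
  \sum_(j < k.+1) 'C(m + k.+1 - j, k.+1)%:R * d j.
Proof.
move=> d0; under eq_bigr => n _ do rewrite binomial_convolution//.
elim: m => [|m IH].
  rewrite big_ord1; apply: eq_bigr => j _.
  rewrite !add0n subSn ?binS; last by rewrite -ltnS.
  by rewrite [X in (X + _)%N]bin_small// ltnS leq_subr.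
rewrite big_ord_recr /= IH -big_split /=; apply: eq_bigr => j _.
have jk := ltn_ord j; have -> : (m.+1 + k.+1 - j = (m + k.+1 - j).+1)%N by lia.
rewrite binS natrD mulrDl; congr (_ + 'C(_, _)%:R * _); lia.
Qed.

Lemma meixner_sqr n q x : 0 < q ->
  meixner n q x ^+ 2 = q ^+ n * meixner_sum (1 - q^-1) n x ^+ 2.
Proof.
move=> q0; rewrite /meixner hyp2F1_opp2 exprMn.
rewrite -[(q `^ _) ^+ 2]powR_mulrn ?powR_ge0//.
by rewrite -powRrM divfK ?pnatr_eq0// powR_mulrn ?ltW.
Qed.

Lemma negbin1 q x : q < 1 -> negbin q 1 x = q ^+ x * (1 - q).
Proof.
by move=> q1; rewrite /negbin pochhammer1 divff ?mul1r ?powRr1 ?subr_ge0 ?ltW.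
Qed.

Lemma negbin2 q x : q < 1 -> negbin q 2 x = x.+1%:R * q ^+ x * (1 - q) ^+ 2.
Proof.
move=> q1; rewrite /negbin powR_mulrn ?subr_ge0 ?ltW// (pochhammer_nat _ 1).
rewrite natrM [_ * _ / _]mulrAC divff ?mul1r ?pnatr_eq0 -?lt0n ?fact_gt0//.
by rewrite add1n binSn.
Qed.

(** On the diagonal the signs of [sbin] square away, and with j = n - l the powers of q combine to n
    - l - 2j = -j. *)
Lemma gram_coef_diag q k n : 0 < q ->
  q ^+ n * gram_coef q k n.+1 n.+1 =
  \sum_(l < n.+1) 'C(l + k, k)%:R *
    (('C(k, n - l) * 'C(k, n - l))%:R * q^-1 ^+ (n - l)).
Proof.
move=> q0; rewrite mulr_sumr; apply: eq_bigr => l _.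
have ln : (l <= n)%N by rewrite -ltnS.
rewrite subSn//= -[in q ^+ n](subnK ln) exprD.
have h i : q ^+ i * q^-1 ^+ i = 1 by rewrite -exprMn mulfV ?expr1n// gt_eqF.
rewrite natrM; set c := 'C(k, _)%:R; set e := 'C(_, k)%:R; set j := (n - l)%N.
transitivity ((q ^+ j * q^-1 ^+ j) * (q ^+ l * q^-1 ^+ l) *
   ((-1) ^+ j * (-1) ^+ j)
   * (e * (c * c * q^-1 ^+ j))).
  by rewrite [(- q^-1) ^+ j]exprNn; ring.
by rewrite !h -exprMn mulrNN !mulr1 expr1n !mul1r.
Qed.

Lemma meixner_moment q k m : 0 < q -> q < 1 ->
  pmf_integral (meixner_density m.+1 q) (fun x => ((x ^_ k)%:R)%:E) =
  (m.+1%:R^-1 * k`!%:R * (q / (1 - q)) ^+ k *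
    \sum_(j < k.+1) 'C(m + k.+1 - j, k.+1)%:R *
       (('C(k, j) * 'C(k, j))%:R * q^-1 ^+ j))%:E.
Proof.
move=> q0 q1; have q1n : 1 - q != 0 by rewrite subr_eq0 gt_eqF.
have qk : (1 - q) ^+ k != 0 by rewrite expf_neq0.
rewrite -(@binomial_convolution_sum _ _
    (fun j => ('C(k, j) * 'C(k, j))%:R * q^-1 ^+ j)); last first.
  by move=> j kj; rewrite bin_small// mul0r.
under eq_bigr do rewrite -gram_coef_diag//.
rewrite /pmf_integral; under eq_eseriesr do rewrite -EFinM.
apply: eseries_EFin.
have -> : (fun x => (x ^_ k)%:R * meixner_density m.+1 q x) = (fun x =>
    m.+1%:R^-1 * k`!%:R * (1 - q) * \sum_(n < m.+1) q ^+ n *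
      ('C(x, k)%:R * q ^+ x * (smeixner q n.+1 x * smeixner q n.+1 x))).
  apply/funext => x; rewrite /meixner_density -bin_ffact natrM !mulr_sumr.
  by apply: eq_bigr => n _; rewrite meixner_sqr// negbin1//= expr2; ring.
rewrite series_mull series_sum.
have -> : m.+1%:R^-1 * k`!%:R * (q / (1 - q)) ^+ k *
     (\sum_(i < m.+1) q ^+ i * gram_coef q k i.+1 i.+1) =
   m.+1%:R^-1 * k`!%:R * (1 - q) *
     (\sum_(i < m.+1) q ^+ i *
       (q ^+ k / (1 - q) ^+ k.+1 * gram_coef q k i.+1 i.+1)).
  rewrite !mulr_sumr; apply: eq_bigr => i _.
  by rewrite expr_div_n exprS; field; rewrite qk q1n nat1r pnatr_eq0.
apply: cvgM; first exact: cvg_cst.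
apply: cvg_big => [|i _]; first exact: add_continuous.
rewrite series_mull.
by apply: cvgM; [exact: cvg_cst | exact: smeixner_series_cvg].
Qed.

(** The factor m + 1 of the outer measure cancels the 1/(m+1) of the one-point function. Each j then
    gives a shifted binomial series with ratio tq and p = k + 1; its denominator (1 - tq)^(k+2)
    loses two factors to the normalisation, and q^(-j) (tq)^j = t^j. *)
Lemma binomialised_moment_sum q t k :
  0 < q -> q < 1 -> 0 < t -> t * q < 1 ->
  binomialised_moment q k t =
    (k`!%:R * (q / ((1 - q) * (1 - t * q))) ^+ k
       * \sum_(j < k.+1) ('C(k, j) * 'C(k, j))%:R * t ^+ j)%:E.
Proof.
move=> q0 q1 t0 tq1; have q1n : 1 - q != 0 by rewrite subr_eq0 gt_eqF.
have tqn : 1 - t * q != 0 by rewrite subr_eq0 gt_eqF.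
have qk : (1 - q) ^+ k != 0 by rewrite expf_neq0.
have tqk : (1 - t * q) ^+ k != 0 by rewrite expf_neq0.
rewrite /binomialised_moment /pmf_integral.
under eq_eseriesr => m _.
  rewrite -/(pmf_integral (meixner_density m.+1 q) _) meixner_moment// -EFinM.
  over.
apply: eseries_EFin.
have -> : (fun m => m.+1%:R^-1 * k`!%:R * (q / (1 - q)) ^+ k *
    (\sum_(j < k.+1) 'C(m + k.+1 - j, k.+1)%:R *
       (('C(k, j) * 'C(k, j))%:R * q^-1 ^+ j)) * negbin (t * q) 2 m) =
  (fun m => k`!%:R * (q / (1 - q)) ^+ k * (1 - t * q) ^+ 2 *
    (\sum_(j < k.+1) ('C(k, j) * 'C(k, j))%:R * q^-1 ^+ j *
       ('C(m + k.+1 - j, k.+1)%:R * (t * q) ^+ m))).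
  apply/funext => m; rewrite negbin2// !mulr_sumr mulr_suml.
  by apply: eq_bigr => j _; field; rewrite nat1r pnatr_eq0.
rewrite series_mull series_sum.
have -> : k`!%:R * (q / ((1 - q) * (1 - t * q))) ^+ k
       * (\sum_(j < k.+1) ('C(k, j) * 'C(k, j))%:R * t ^+ j) =
  k`!%:R * (q / (1 - q)) ^+ k * (1 - t * q) ^+ 2 *
    (\sum_(j < k.+1) ('C(k, j) * 'C(k, j))%:R * q^-1 ^+ j *
       ((t * q) ^+ j / (1 - t * q) ^+ k.+2)).
  rewrite !mulr_sumr; apply: eq_bigr => j _.
  have -> : t ^+ j = q^-1 ^+ j * (t * q) ^+ j.
    by rewrite -exprMn mulrCA mulVf ?mulr1// gt_eqF.
  rewrite !expr_div_n exprMn !exprS.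
  by field; rewrite qk tqk tqn.
apply: cvgM; first exact: cvg_cst.
apply: cvg_big => [|j _]; first exact: add_continuous.
rewrite series_mull.
apply: cvgM; first exact: cvg_cst.
apply: shifted_binomial_series_cvg; last exact: ltnW.
by rewrite mulr_gt0.
Qed.

End Moments.

Unset Implicit Arguments.
Set Strict Implicit.

Theorem theorem7 (R : realType) (q t : R) (k : nat)
    (q_gt0 : 0 < q) (q_lt1 : q < 1) (t_gt0 : 0 < t) (tq_lt1 : t * q < 1) :
  binomialised_moment q k t =
    (k`!%:R * (q / ((1 - q) * (1 - t * q))) ^+ k
       * hyp2F1 (- k%:R) (- k%:R) 1 t)%:E
  /\
  (* p is the polynomial given off 1 by (1 - s)^k P_k((1 + s) / (1 - s)) *)
  exists p : {poly R},
    (forall s : R, s != 1 ->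
       p.[s] = (1 - s) ^+ k * legendre k ((1 + s) / (1 - s)))
    /\ binomialised_moment q k t =
         (k`!%:R * (q / ((1 - q) * (1 - t * q))) ^+ k * p.[t])%:E.
Proof.
rewrite hyp2F1_opp2 binomialised_moment_sum//; split=> //.
pose p : {poly R} := \poly_(j < k.+1) ('C(k, j) * 'C(k, j))%:R.
by exists p; split=> [s s1|]; rewrite horner_poly ?legendre_polynomial.
Qed.
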